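(* Let $\{p_n(x)\}_{n\ge 0}$ be an orthogonal polynomial sequence with $[x^n]p_n(x)\neq 0$ for all $n$, satisfying the three-term recurrence $$x\,p_n(x)=\alpha_np_{n+1}(x)+\beta_np_n(x)+\gamma_np_{n-1}(x),\qquad n\ge 0,\quad p_{-1}(x)=0,$$ and let $A=(a_{n,k})_{n,k\ge 0}$ be its coefficient matrix, $p_n(x)=\sum_{k=0}^n a_{n,k}x^k$. Then the inverse matrix $A^{-1}$ exists, and the production matrix of $A^{-1}$ is a tridiagonal matrix that represents the three-term recurrence of $\{p_n(x)\}$, namely the Jacobi matrix $$J=\begin{pmatrix}\beta_0&\alpha_0&0&0&\cdots\\ \gamma_1&\beta_1&\alpha_1&0&\cdots\\ 0&\gamma_2&\beta_2&\alpha_2&\cdots\\ \vdots&\vdots&\ddots&\ddots&\ddots\end{pmatrix}.$$ Furthermore, the first column of $A^{-1}$ is the moment sequence of $\{p_n(x)\}$: if $L$ is the linear functional defining the orthogonality, normalized so that $L[p_0]=1$, then $(A^{-1})_{n,0}=L(x^n)$ for all $n\ge 0$.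
   Context: An orthogonal polynomial sequence (OPS) is a sequence of polynomials $p_n$ with $\deg p_n=n$ for which there is a linear functional $L$ on polynomials with $L[p_mp_n]=0$ for $m\neq n$ and $L[p_n^2]\ne 0$; its moments are $\mu_k=L(x^k)$. Let $S=(\delta_{n,k-1})_{n,k\ge 0}$ be the infinite upper shift matrix (ones on the first superdiagonal, zeros elsewhere). For an invertible infinite lower triangular matrix $B$, the production matrix of $B$ is $P_B=B^{-1}SB$; thus the production matrix of $A^{-1}$ is $ASA^{-1}$. *)

(* Defs.v *)
From mathcomp Require Import all_boot all_order all_algebra.
From mathcomp Require Import boolp classical_sets functions fsbigop.

Set Implicit Arguments.
Unset Strict Implicit.
Unset Printing Implicit Defensive.
Import GRing.Theory.
Local Open Scope ring_scope.

(** * Infinite matrices, with rows and columns indexed from 0 *)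

Definition infmx (F : fieldType) := nat -> nat -> F.

(* The sum is over all k : nat. It is the actual sum when only finitely many
   terms are nonzero, in particular when A is row-finite; otherwise the library
   convention makes it 0. *)
Definition infmx_mul (F : fieldType) (A B : infmx F) : infmx F :=
  fun i j => \sum_(k \in [set: nat]) A i k * B k j.

Definition infmx1 (F : fieldType) : infmx F := fun i j => (i == j)%:R.

(* Written j = i + 1 rather than i = j - 1, since subtraction on nat truncates. *)
Definition shift_mx (F : fieldType) : infmx F := fun i j => (j == i.+1)%:R.

Definition lower_triangular (F : fieldType) (A : infmx F) :=
  forall i j : nat, (i < j)%N -> A i j = 0.

Definition tridiagonal (F : fieldType) (A : infmx F) :=
  forall i j : nat, (i.+1 < j)%N || (j.+1 < i)%N -> A i j = 0.

(* Inverses are taken among lower triangular matrices, where the product is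
   associative, so that a two-sided inverse is unique. *)
Definition lower_inverse (F : fieldType) (A B : infmx F) :=
  [/\ lower_triangular B,
      infmx_mul A B = infmx1 F & infmx_mul B A = infmx1 F].

Definition lower_invertible (F : fieldType) (A : infmx F) :=
  lower_triangular A /\ exists B : infmx F, lower_inverse A B.

(* The inverse of A if there is one, and the zero matrix otherwise. *)
Definition infmx_inv (F : fieldType) (A : infmx F) : infmx F :=
  xget (fun _ _ => 0) [set B : infmx F | lower_inverse A B]%classic.

Definition production_mx (F : fieldType) (B : infmx F) : infmx F :=
  infmx_mul (infmx_mul (infmx_inv B) (shift_mx F)) B.

Definition jacobi_mx (F : fieldType) (alpha beta gamma : nat -> F) : infmx F :=
  fun i j =>
    if j == i.+1 then alpha i
    else if j == i then beta i
    else if i == j.+1 then gamma i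
    else 0.

(** * Orthogonal polynomial sequences *)

Definition orthogonal_for (F : fieldType) (L : {scalar {poly F}})
    (p : nat -> {poly F}) :=
  (forall m n : nat, m != n -> L (p m * p n) = 0) /\
  (forall n : nat, L (p n ^+ 2) != 0).

Definition is_OPS (F : fieldType) (p : nat -> {poly F}) :=
  (forall n : nat, size (p n) = n.+1) /\
  exists L : {scalar {poly F}}, orthogonal_for L p.

Definition moment (F : fieldType) (L : {scalar {poly F}}) (n : nat) : F :=
  L 'X^n.

(* p_(n-1), with p_(-1) = 0. *)
Definition prev_poly (F : fieldType) (p : nat -> {poly F}) (n : nat) : {poly F} :=
  if n is m.+1 then p m else 0.

Definition three_term_recurrence (F : fieldType) (p : nat -> {poly F})
    (alpha beta gamma : nat -> F) :=
  forall n : nat,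
    'X * p n = alpha n *: p n.+1 + beta n *: p n + gamma n *: prev_poly p n.

Definition coef_infmx (F : fieldType) (p : nat -> {poly F}) : infmx F :=
  fun n k => (p n)`_k.

(* Main.v *)
Require Import Defs.
From mathcomp Require Import all_boot all_order all_algebra.
From mathcomp Require Import boolp classical_sets functions fsbigop.
Import GRing.Theory.
Local Open Scope ring_scope.

(** Reading the recurrence coefficientwise gives [A S = J A], and so
    [A S A^-1 = J A A^-1 = J].  The n-th row of [A^-1] expands [x^n] in the basis
    [p_k], and [L] kills every [p_k] with [k > 0] because [p_0] is a nonzero
    constant; applying [L] to the expansion leaves the entry of index 0. *)

(** Weaker than lower triangular: it also covers the Jacobi matrix, and suffices to make products
    genuine finite sums. *)
Definition row_finite {F : fieldType} (A : infmx F) :=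
  exists r : nat -> nat, forall i j : nat, (r i <= j)%N -> A i j = 0.

Lemma lower_row_finite {F : fieldType} {A : infmx F} :
  lower_triangular A -> row_finite A.
Proof. by move=> lA; exists S => i j ij; apply: lA. Qed.

Lemma infmx_mulE {F : fieldType} {A : infmx F} (B : infmx F) {i} j n :
  (forall k, (n <= k)%N -> A i k = 0) ->
  infmx_mul A B i j = \sum_(k < n) A i k * B k j.
Proof.
move=> A0; rewrite /infmx_mul (fsbig_ord _ _ (fun k => A i k * B k j)).
apply/esym/fsbig_widen => [//|k [_ /= /negP]].
by rewrite -leqNgt => nk; rewrite A0 // mul0r.
Qed.

(** Row-finiteness of the two left factors makes each entry a finite double sum, so summations can
    be exchanged for arbitrary [C]. *)
Lemma infmx_mulA {F : fieldType} {A B C : infmx F} :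
  row_finite A -> row_finite B ->
  infmx_mul (infmx_mul A B) C = infmx_mul A (infmx_mul B C).
Proof.
move=> [r rA] [s sB]; apply/funext => i; apply/funext => j.
(* Row [i] of [A] meets only the rows [k < r i] of [B]; [m] bounds all their supports, hence that of
   row [i] of the product. *)
pose m := (\max_(k < r i) s k)%N.
have Bm (k : 'I_(r i)) l : (m <= l)%N -> B k l = 0.
  by move=> ml; apply/sB/(leq_trans _ ml)/(leq_bigmax k).
have ABm l : (m <= l)%N -> infmx_mul A B i l = 0.
  move=> ml; rewrite (infmx_mulE _ _ _ (rA i)) big1 // => k _.
  by rewrite Bm // mulr0.
rewrite (infmx_mulE _ _ _ ABm) (infmx_mulE _ _ _ (rA i)).
under eq_bigr do rewrite (infmx_mulE _ _ _ (rA i)) mulr_suml.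
rewrite exchange_big; apply: eq_bigr => k _ /=.
rewrite (infmx_mulE _ _ _ (Bm k)) mulr_sumr.
by apply: eq_bigr => l _; rewrite mulrA.
Qed.

Lemma infmx1_lower (F : fieldType) : lower_triangular (infmx1 F).
Proof. by move=> i j ij; rewrite /infmx1 (ltn_eqF ij). Qed.

Lemma infmx_mul1l {F : fieldType} {A : infmx F} : infmx_mul (infmx1 F) A = A.
Proof.
apply/funext => i; apply/funext => j.
rewrite (infmx_mulE _ _ i.+1); last exact: infmx1_lower.
rewrite big_ord_recr /= big1 ?add0r => [|k _]; rewrite /infmx1 ?eqxx ?mul1r //.
by rewrite (gtn_eqF (ltn_ord k)) mul0r.
Qed.

Lemma infmx_mul1r {F : fieldType} {A : infmx F} :
  row_finite A -> infmx_mul A (infmx1 F) = A.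
Proof.
move=> [r rA]; apply/funext => i; apply/funext => j.
have Am k : (maxn (r i) j.+1 <= k)%N -> A i k = 0.
  by rewrite geq_max => /andP[+ _]; apply: rA.
have jm : (j < maxn (r i) j.+1)%N by rewrite leq_maxr.
rewrite (infmx_mulE _ _ _ Am) (bigD1 (Ordinal jm)) //= big1 => [|k kj].
  by rewrite /infmx1 eqxx mulr1 addr0.
by rewrite /infmx1 -[j]/(val (Ordinal jm)) val_eqE (negPf kj) mulr0.
Qed.

Lemma lower_inverse_sym {F : fieldType} {A B : infmx F} :
  lower_triangular A -> lower_inverse A B -> lower_inverse B A.
Proof. by move=> lA [_ AB BA]. Qed.

Lemma lower_inverse_uniq {F : fieldType} {A B C : infmx F} :
  lower_triangular A -> lower_inverse A B -> lower_inverse A C -> B = C.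
Proof.
move=> /lower_row_finite fA [/lower_row_finite fB _ BA] [lC AC _].
by rewrite -[C]infmx_mul1l -BA infmx_mulA // AC infmx_mul1r.
Qed.

Lemma infmx_invE {F : fieldType} {A B : infmx F} :
  lower_triangular A -> lower_inverse A B -> infmx_inv A = B.
Proof.
move=> lA AB; apply: (lower_inverse_uniq lA _ AB).
by rewrite /infmx_inv; case: xgetP => [_ -> //|/(_ B)].
Qed.

(** Back substitution: among the first [n] rows only the last reaches the last column, so it alone
    fixes the last coefficient, and induction handles the rest. *)
Lemma lower_row_span {F : fieldType} {A : infmx F} :
  lower_triangular A -> (forall n, A n n != 0) ->
  forall n (v : nat -> F), (forall j, (n <= j)%N -> v j = 0) ->
  exists c : nat -> F, (forall k, (n <= k)%N -> c k = 0) /\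
    forall j, \sum_(k < n) c k * A k j = v j.
Proof.
move=> lA dA; elim=> [|n IHn] v v0.
  by exists (fun=> 0); split=> // j; rewrite big_ord0 v0.
(* Subtracting [a] times row [n] clears entry [n] of [v], leaving a vector supported below [n]. *)
pose a := v n / A n n.
have [|c [c0 cE]] := IHn (fun j => v j - a * A n j).
  move=> j; rewrite leq_eqVlt => /predU1P[<-|nj].
    by rewrite /a divfK ?subrr.
  by rewrite v0 // lA // mulr0 subrr.
exists (fun k => if k == n then a else c k); split=> [k nk|j].
  by rewrite gtn_eqF // c0 // ltnW.
rewrite big_ord_recr /= eqxx.
under eq_bigr => k _ do rewrite (ltn_eqF (ltn_ord k)).
by rewrite cE subrK.
Qed.

Lemma lower_left_inverse {F : fieldType} {A : infmx F} :
  lower_triangular A -> (forall n, A n n != 0) ->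
  exists B, lower_triangular B /\ infmx_mul B A = infmx1 F.
Proof.
move=> lA dA.
(* Row [n] of [B] consists of the coefficients expressing row [n] of the identity through rows [0]
   to [n] of [A]. *)
have /choice[B BP] n := lower_row_span lA dA n.+1 _ (infmx1_lower F n).
have lB : lower_triangular B by move=> i j; apply: (BP i).1.
exists B; split=> //; apply/funext => i; apply/funext => j.
by rewrite (infmx_mulE _ _ _ (lB i)) (BP i).2.
Qed.

Lemma lower_diag_invertible {F : fieldType} {A : infmx F} :
  lower_triangular A -> (forall n, A n n != 0) -> lower_invertible A.
Proof.
move=> lA dA; split=> //; have [B [lB BA]] := lower_left_inverse lA dA.
(* By triangularity the diagonal entry of [B A] is [B n n * A n n], and it equals 1. *)
have dB n : B n n != 0.
  apply: contra_neq (oner_neq0 F) => Bn.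
  have := congr1 (fun M : infmx F => M n n) BA.
  rewrite (infmx_mulE _ _ _ (lB n)) /infmx1 eqxx mulr1n => <-.
  rewrite big_ord_recr /= Bn mul0r addr0 big1 // => k _.
  by rewrite lA ?mulr0.
(* The left inverse of the left inverse is A, so B is two-sided. *)
have [C [lC CB]] := lower_left_inverse lB dB.
have CA : C = A.
  rewrite -[A]infmx_mul1l -CB infmx_mulA ?BA ?infmx_mul1r //;
    exact: lower_row_finite.
by exists B; split; rewrite // -CA.
Qed.

Lemma jacobi_tridiagonal {F : fieldType} (alpha beta gamma : nat -> F) :
  tridiagonal (jacobi_mx alpha beta gamma).
Proof.
move=> i j /orP[] ij; rewrite /jacobi_mx.
  by rewrite (gtn_eqF ij) (gtn_eqF (ltnW ij)) ltn_eqF // ltnW // ltnW.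
by rewrite (gtn_eqF ij) (ltn_eqF (ltnW ij)) ltn_eqF // ltnW // ltnW.
Qed.

Lemma jacobi_row_finite {F : fieldType} (alpha beta gamma : nat -> F) :
  row_finite (jacobi_mx alpha beta gamma).
Proof.
by exists (fun i => i.+2) => i j ij; apply: jacobi_tridiagonal; rewrite ij.
Qed.

(** Right multiplication by the shift moves every row one place to the right, as multiplication by
    ['X] does to coefficients. *)
Lemma coef_infmx_shift {F : fieldType} {p : nat -> {poly F}}
    (lA : lower_triangular (coef_infmx p)) n k :
  infmx_mul (coef_infmx p) (shift_mx F) n k = ('X * p n)`_k.
Proof.
rewrite coefXM; case: k => [|k] /=.
  rewrite (infmx_mulE _ _ _ (lA n)) big1 // => l _.
  by rewrite /shift_mx mulr0.
(* With [A] written as [A] times the identity, both sides are sums over the same range and agree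
   term by term. *)
rewrite -[RHS]/(coef_infmx p n k) -[in RHS](@infmx_mul1r _ (coef_infmx p)).
  by rewrite !(infmx_mulE _ _ _ (lA n)); apply: eq_bigr => l _;
     rewrite /shift_mx /infmx1 eqSS eq_sym.
exact: lower_row_finite.
Qed.

Lemma jacobi_mul_coef {F : fieldType} (p : nat -> {poly F})
    (alpha beta gamma : nat -> F) n k :
  infmx_mul (jacobi_mx alpha beta gamma) (coef_infmx p) n k =
  (alpha n *: p n.+1 + beta n *: p n + gamma n *: prev_poly p n)`_k.
Proof.
rewrite (infmx_mulE _ _ n.+2) => [|l nl]; last first.
  by apply: jacobi_tridiagonal; rewrite nl.
rewrite !coefD !coefZ !big_ord_recr /= /jacobi_mx /coef_infmx.
rewrite !eqxx (ltn_eqF (ltnSn n)) [RHS]addrC [X in _ = _ + X]addrC addrA.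
congr (_ + _ + _).
(* What remains is the part left of the diagonal: empty in row 0, matching the convention that the
   polynomial of index -1 is 0, and otherwise the single [gamma] entry. *)
case: n => [|n] /=; first by rewrite big_ord0 coef0 mulr0.
rewrite big_ord_recr /= big1 => [|l _].
  by rewrite add0r 2?ltn_eqF // eqxx.
have ln := ltn_ord l.
by rewrite (ltn_eqF (leqW (leqW ln))) (ltn_eqF (leqW ln)) eqSS gtn_eqF // mul0r.
Qed.

Lemma orthogonal_eq0 {F : fieldType} {L : {scalar {poly F}}}
    {p : nat -> {poly F}} {k} :
  orthogonal_for L p -> size (p 0%N) = 1%N -> k != 0%N -> L (p k) = 0.
Proof.
move=> [Lp _] /eqP/size_poly1P[c c0 pc] k0; apply: (mulfI c0).
by rewrite mulr0 -linearZ -mul_polyC -pc mulrC Lp.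
Qed.

Theorem theorem4p4 (F : fieldType) (p : nat -> {poly F})
    (alpha beta gamma : nat -> F)
    (p_OPS : is_OPS p)
    (p_lead : forall n : nat, (p n)`_n != 0)
    (p_rec : three_term_recurrence p alpha beta gamma) :
  let A := coef_infmx p in
  [/\ lower_invertible A,
      tridiagonal (production_mx (infmx_inv A)),
      production_mx (infmx_inv A) = jacobi_mx alpha beta gamma &
      forall L : {scalar {poly F}},
        orthogonal_for L p -> L (p 0%N) = 1 ->
        forall n : nat, infmx_inv A n 0%N = moment L n].
Proof.
move=> A; have [sp _] := p_OPS.
have lA : lower_triangular A by move=> i j ij; apply: nth_default; rewrite sp.
have invA := lower_diag_invertible lA p_lead.
have [_ [B AB]] := invA; have [lB mAB mBA] := AB.
have AE := infmx_invE lA AB.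
have prodE : production_mx (infmx_inv A) = jacobi_mx alpha beta gamma.
  (* The inverse of [B] is [A], so the production matrix becomes [A S B]. *)
  rewrite AE /production_mx (infmx_invE lB (lower_inverse_sym lA AB)).
  have -> : infmx_mul A (shift_mx F) = infmx_mul (jacobi_mx alpha beta gamma) A.
    apply/funext => n; apply/funext => k.
    by rewrite coef_infmx_shift // jacobi_mul_coef p_rec.
  have fJ := jacobi_row_finite alpha beta gamma.
  by rewrite infmx_mulA ?mAB ?infmx_mul1r //; apply: lower_row_finite.
split=> //; first by rewrite prodE; apply: jacobi_tridiagonal.
move=> L Lp L1 n; rewrite AE.
(* This is row [n] of [B A = 1], read as an identity of polynomials. *)
have XnE : 'X^n = \sum_(k < n.+1) B n k *: p k.
  apply/polyP => j; rewrite coefXn coef_sum.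
  under eq_bigr do rewrite coefZ.
  by rewrite -(infmx_mulE A _ _ (lB n)) mBA eq_sym.
rewrite /moment XnE linear_sum big_ord_recl /= linearZ /= L1 mulr1.
rewrite big1 ?addr0 // => k _.
by rewrite linearZ /= (orthogonal_eq0 Lp (sp 0%N)) ?mulr0.
Qed.
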